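(* Let $P$ be a finite poset with minimum $\hat0$ and maximum $\hat1$, and let $M$ be a special partial matching on $P$. Then a poset isomorphic to $P$ can be obtained from $[\hat0,M(\hat1)]\times\mathbf{2}$ by a sequence of clean zippings and removals.
   Context: $\mathbf{2}=\{\alpha<\beta\}$. Writing $\lessdot$ for cover, an SPM on $P$ is $M:P\to P$ with $M^2=\mathrm{id}$; $M(\hat1)\lessdot\hat1$; for all $x$, $M(x)\lessdot x$, $M(x)=x$, or $x\lessdot M(x)$; and if $x\lessdot y$, $M(x)\neq y$ then $M(x)<M(y)$. For a finite poset $Q$ with $\hat0,\hat1$: a zipper is a triple $(x,y,z)$ of distinct elements with $z$ covering only $x$ and $y$, $z=x\vee y$, and $[\hat0,x)=[\hat0,y)$; it is clean if $z\neq\hat1$ and there exist a coatom $c$ and an isomorphism $\varphi:[x,\hat1]\to[x,c]\times\mathbf{2}$ with $\varphi(z)=(x,\beta)$. A clean zipping replaces $Q$ by $(Q-\{x,y,z\})\uplus\{xyz\}$ with order: $a\leq' b$ iff $a\leq b$ for old elements; $xyz\leq' a$ iff $x\leq a$ or $y\leq a$; $a\leq' xyz$ iff $a\leq x$; $xyz\leq' xyz$. An element $z\neq\hat1$ is removable if it covers exactly one element $x$ and there exist a coatom $c$ and an isomorphism $\varphi:[x,\hat1]\to[x,c]\times\mathbf{2}$ with $\varphi(z)=(x,\beta)$; a removal replaces $Q$ by $Q-\{z\}$ (induced order). *)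

(* Defs.v *)
From HB Require Import structures.
From mathcomp Require Import all_boot all_order.

Set Implicit Arguments.
Unset Strict Implicit.
Unset Printing Implicit Defensive.

Import Order.Theory.
Local Open Scope order_scope.

Definition covered_by {d} {T : porderType d} (x y : T) : Prop :=
  x < y /\ forall w : T, ~~ (x < w < y).

Definition coatom {d} {T : tPOrderType d} (c : T) : Prop := covered_by c \top.

Definition poset_iso {d d'} {T : porderType d} {T' : porderType d'}
    (f : T -> T') : Prop :=
  bijective f /\ {mono f : x y / x <= y}.

Definition isomorphic {d d'} (T : porderType d) (T' : porderType d') : Prop :=
  exists f : T -> T', poset_iso f.

Definition itv {d} {T : porderType d} (x y : T) : Type := {a : T | x <= a <= y}.

HB.instance Definition _ d (T : porderType d) (x y : T) :=
  SubChoice.on (itv x y).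
HB.instance Definition _ d (T : porderType d) (x y : T) :=
  [SubChoice_isSubPOrder of itv x y by <: with d].
HB.instance Definition _ d (T : finPOrderType d) (x y : T) :=
  [Finite of itv x y by <:].

Section LowerInterval.
Context {d : Order.disp_t} {T : finTBPOrderType d} (y : T).

Fact itv_bot_proof : (\bot : T) <= \bot <= y.
Proof. by rewrite lexx le0x. Qed.

Fact itv_top_proof : (\bot : T) <= y <= y.
Proof. by rewrite lexx le0x. Qed.

Fact itv_le0x (a : itv \bot y) : (Sub \bot itv_bot_proof : itv \bot y) <= a.
Proof. by rewrite -Order.le_val SubK le0x. Qed.

Fact itv_lex1 (a : itv \bot y) : a <= (Sub y itv_top_proof : itv \bot y).
Proof. by rewrite -Order.le_val SubK; case/andP: (valP a). Qed.

HB.instance Definition _ := Order.hasBottom.Build d (itv \bot y) itv_le0x.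
HB.instance Definition _ := Order.hasTop.Build d (itv \bot y) itv_lex1.
End LowerInterval.

Record special_partial_matching {d} {P : finTBPOrderType d} (M : P -> P) : Prop :=
  SpecialPartialMatching {
    spm_inv : involutive M;
    spm_top : covered_by (M \top) \top;
    spm_cov : forall x, covered_by (M x) x \/ M x = x \/ covered_by x (M x);
    spm_mono : forall x y, covered_by x y -> M x <> y -> M x < M y }.

(* The chain 2 = {alpha < beta} is bool, with alpha = false and beta = true. *)
Definition splits_above {d} {Q : finTBPOrderType d} (x z : Q) : Prop :=
  exists c : Q, coatom c /\
  exists phi : itv x \top -> itv x c *p bool, poset_iso phi /\
  exists u : itv x \top,
    [/\ val u = z, val (phi u).1 = x & (phi u).2 = true].

Record zipper {d} {Q : finTBPOrderType d} (x y z : Q) : Prop := Zipper {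
  zipper_uniq : uniq [:: x; y; z];
  zipper_cov : forall w, covered_by w z <-> w = x \/ w = y;
  zipper_join : [/\ x <= z, y <= z & forall w, x <= w -> y <= w -> z <= w];
  zipper_below : forall a, (a < x) = (a < y) }.

Record clean_zipper {d} {Q : finTBPOrderType d} (x y z : Q) : Prop :=
  CleanZipper {
    clean_zipperW : zipper x y z;
    clean_zipper_top : z != \top;
    clean_zipper_split : splits_above x z }.

(* [None] is the merged element xyz. *)
Definition zipping {d} {Q : finTBPOrderType d} {x y z : Q}
    (h : clean_zipper x y z) : Type :=
  option {a : Q | a \notin [:: x; y; z]}.

HB.instance Definition _ d (Q : finTBPOrderType d) (x y z : Q)
  (h : clean_zipper x y z) := Finite.on (zipping h).

Section Zipping.
Context {d : Order.disp_t} {Q : finTBPOrderType d} {x y z : Q}.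
Variable h : clean_zipper x y z.

Definition zipping_le (a b : zipping h) : bool :=
  match a, b with
  | Some a, Some b => val a <= val b
  | None, Some b => (x <= val b) || (y <= val b)
  | Some a, None => val a <= x
  | None, None => true
  end.

Let old_lt (a : Q) : a \notin [:: x; y; z] -> a <= x -> (a < x) && (a < y).
Proof.
rewrite !inE !negb_or => /and3P[ax _ _] le_ax.
by rewrite -(zipper_below (clean_zipperW h)) andbb lt_neqAle ax.
Qed.

Let old_contra (a : Q) :
  a \notin [:: x; y; z] -> a <= x -> (x <= a) || (y <= a) = false.
Proof.
move=> ha /(old_lt ha)/andP[ax ay].
by apply/negbTE; rewrite negb_or (lt_geF ax) (lt_geF ay).
Qed.

Fact zipping_refl : reflexive zipping_le.
Proof. by case=> [a|] /=. Qed.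

Fact zipping_anti : antisymmetric zipping_le.
Proof.
case=> [a|] [b|] //=; first by move=> /le_anti/val_inj->.
- by case/andP=> /(old_contra (valP a)) ->.
- by case/andP=> + /(old_contra (valP b)) => ->.
Qed.

Fact zipping_trans : transitive zipping_le.
Proof.
case=> [b|] [a|] [c|] //=; first exact: le_trans.
- exact: le_trans.
- by move=> /orP[] h1 h2; rewrite (le_trans h1 h2) ?orbT.
- move=> /(old_lt (valP a))/andP[/ltW ax /ltW ay].
  by case/orP; apply: le_trans.
Qed.

HB.instance Definition _ := Order.Le_isPOrder.Build d (zipping h)
  zipping_refl zipping_anti zipping_trans.

Let le_xz : x <= z. Proof. by case: (zipper_join (clean_zipperW h)). Qed.
Let le_yz : y <= z. Proof. by case: (zipper_join (clean_zipperW h)). Qed.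
Let neq_xy : x != y.
Proof.
by have := zipper_uniq (clean_zipperW h); rewrite /= !inE negb_or => /andP[/andP[]].
Qed.

Fact zipping_bot_proof : (\bot : Q) \notin [:: x; y; z].
Proof.
have bx : x != \bot.
  apply/eqP=> x0; have := zipper_below (clean_zipperW h) \bot.
  by rewrite {1}x0 ltxx lt0x -x0 eq_sym neq_xy.
have by_ : y != \bot.
  apply/eqP=> y0; have := zipper_below (clean_zipperW h) \bot.
  by rewrite [in RHS]y0 ltxx lt0x bx.
rewrite !inE !negb_or eq_sym bx eq_sym by_ eq_sym.
by apply: contraNneq bx => z0; rewrite -lex0 -z0.
Qed.

Fact zipping_top_proof : (\top : Q) \notin [:: x; y; z].
Proof.
have z1 := clean_zipper_top h.
have lt_z1 a : a <= z -> \top != a.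
  by move=> az; apply: contraNneq z1 => a1; rewrite -le1x a1.
by rewrite !inE !negb_or !lt_z1.
Qed.

Fact zipping_le0x (a : zipping h) :
  (Some (Sub \bot zipping_bot_proof) : zipping h) <= a.
Proof. by case: a => [a|]; rewrite /Order.le /= le0x. Qed.

Fact zipping_lex1 (a : zipping h) :
  a <= (Some (Sub \top zipping_top_proof) : zipping h).
Proof. by case: a => [a|]; rewrite /Order.le /= lex1. Qed.

HB.instance Definition _ := Order.hasBottom.Build d (zipping h) zipping_le0x.
HB.instance Definition _ := Order.hasTop.Build d (zipping h) zipping_lex1.
End Zipping.

Record removable {d} {Q : finTBPOrderType d} (z : Q) : Prop := Removable {
  removable_top : z != \top;
  removable_split :
    exists x, (forall w, covered_by w z <-> w = x) /\ splits_above x z }.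

Definition removal {d} {Q : finTBPOrderType d} {z : Q} (h : removable z) : Type :=
  {a : Q | a != z}.

HB.instance Definition _ d (Q : finTBPOrderType d) (z : Q) (h : removable z) :=
  SubChoice.on (removal h).
HB.instance Definition _ d (Q : finTBPOrderType d) (z : Q) (h : removable z) :=
  [SubChoice_isSubPOrder of removal h by <: with d].
HB.instance Definition _ d (Q : finTBPOrderType d) (z : Q) (h : removable z) :=
  [Finite of removal h by <:].

Section Removal.
Context {d : Order.disp_t} {Q : finTBPOrderType d} {z : Q}.
Variable h : removable z.

Fact removal_bot_proof : (\bot : Q) != z.
Proof.
case: h => _ [x [/(_ x) [_ /(_ erefl) [xz _]] _]].
by apply/eqP=> z0; rewrite -z0 ltx0 in xz.
Qed.

Fact removal_top_proof : (\top : Q) != z.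
Proof. by rewrite eq_sym removable_top. Qed.

Fact removal_le0x (a : removal h) :
  (Sub \bot removal_bot_proof : removal h) <= a.
Proof. by rewrite -Order.le_val SubK le0x. Qed.

Fact removal_lex1 (a : removal h) :
  a <= (Sub \top removal_top_proof : removal h).
Proof. by rewrite -Order.le_val SubK lex1. Qed.

HB.instance Definition _ := Order.hasBottom.Build d (removal h) removal_le0x.
HB.instance Definition _ := Order.hasTop.Build d (removal h) removal_lex1.
End Removal.

(* Every poset along the sequence is given the display [d] of the first one. *)
Inductive zip_remove_seq {d} (Q : finTBPOrderType d) : finTBPOrderType d -> Prop :=
  | zrs_nil : zip_remove_seq Q Q
  | zrs_zip (x y z : Q) (h : clean_zipper x y z) (R : finTBPOrderType d) :
      zip_remove_seq (zipping h) R -> zip_remove_seq Q R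
  | zrs_remove (z : Q) (h : removable z) (R : finTBPOrderType d) :
      zip_remove_seq (removal h) R -> zip_remove_seq Q R.

(* Main.v *)
(* The functions max(x, M x) and min(x, M x) are monotone, by induction along
   covers. Write m = M(1). The map sending (p, alpha) to p and (p, beta) to
   max(p, M p) from [0, m] x 2 onto P has fibers of size one, {(p, alpha),
   (p, beta)} when M p = p, and {(p, alpha), (M p, beta), (p, beta)} when
   M p < p. Running through [0, m] along a linear extension, collapse the fiber
   of each p with M p <= p, by a removal if M p = p and a clean zipping if
   M p < p. Once everything strictly below p has been treated, (p, beta)
   covers exactly the other elements of its fiber, while the part above
   (p, alpha) is still an untouched copy of [p, m] x 2. *)
Require Import Defs.
From HB Require Import structures.
From mathcomp Require Import all_boot all_order.

Import Order.Theory.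
Local Open Scope order_scope.

Set Implicit Arguments.
Unset Strict Implicit.
Unset Printing Implicit Defensive.

(** * Monotonicity along covers and computation of covers *)

Lemma le_implyb (b c : bool) : (b <= c) = (b ==> c).
Proof. by case: b c => [] []. Qed.

Section CoverInduction.
Context {d d' : Order.disp_t} {T : finPOrderType d} {T' : porderType d'}.

(** Strong induction on the size of the open interval between [x] and [y]: an intermediate [w]
    splits it into two smaller ones, both missing [w]. *)
Lemma homo_le_covered_by (f : T -> T') :
  (forall x y, covered_by x y -> f x <= f y) -> {homo f : x y / x <= y}.
Proof.
move=> f_cov x y.
have [n] := ubnP #|[set w | x < w < y]|; elim: n x y => // n IHn x y le_n.
rewrite [x <= y]le_eqVlt => /predU1P[->|xy]; first exact: lexx.
case: (pickP (fun w => x < w < y)) => [w /andP[xw wy]|no_w]; last first.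
  by apply: f_cov; split=> // w; rewrite no_w.
have sub_lt (A : {set T}) : A \subset [set w | x < w < y] -> w \notin A ->
    (#|A| < n)%N.
  move=> A_sub wA; rewrite -ltnS; apply: leq_trans le_n; rewrite ltnS.
  apply/proper_card/properP; split=> //.
  by exists w; rewrite // inE xw.
apply: le_trans (IHn x w _ (ltW xw)) (IHn w y _ (ltW wy)); apply: sub_lt.
- apply/subsetP=> v; rewrite !inE => /andP[-> vw] /=; exact: lt_trans wy.
- by rewrite inE ltxx andbF.
- by apply/subsetP=> v; rewrite !inE => /andP[wv ->]; rewrite (lt_trans xw).
- by rewrite inE ltxx.
Qed.
End CoverInduction.

Section Covers.
Context {d : Order.disp_t} {T : porderType d}.

(** [s] is an antichain that generates everything below [z], so its members are exactly the maximal
    elements below [z]. *)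
Lemma covered_by_generators (s : seq T) (z w : T) :
    {in s, forall x, x < z} -> (forall v, v < z -> has (fun x => v <= x) s) ->
    {in s &, forall x y, x <= y -> x = y} ->
  covered_by w z <-> w \in s.
Proof.
move=> s_lt s_gen s_anti; split=> [[wz w_cov]|ws].
  have /hasP[x xs] := s_gen w wz; rewrite le_eqVlt => /predU1P[->//|wx].
  by have := w_cov x; rewrite wx s_lt.
split=> [|v]; first exact: s_lt.
apply/negP=> /andP[wv /s_gen/hasP[x xs vx]].
have wx := lt_le_trans wv vx.
by move: (wx); rewrite (s_anti w x ws xs (ltW wx)) ltxx.
Qed.
End Covers.

(** * The larger and the smaller member of a matched pair *)

Section Matching.
Context {d : Order.disp_t} {P : finTBPOrderType d} (M : P -> P).
Hypothesis hM : special_partial_matching M.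

Definition pair_max (x : P) : P := if x <= M x then M x else x.
Definition pair_min (x : P) : P := if x <= M x then x else M x.

Local Notation j := pair_max.
Local Notation k := pair_min.
Local Notation m := (M \top).

(** A view: one case split rewrites [M x], [j x] and [k x] together. *)
Variant pair_spec (x : P) : P -> P -> P -> Prop :=
  | PairUp of x < M x : pair_spec x (M x) (M x) x
  | PairFixed of M x = x : pair_spec x x x x
  | PairDown of M x < x : pair_spec x (M x) x (M x).

Lemma pairP x : pair_spec x (M x) (j x) (k x).
Proof.
rewrite /j /k; have [[lt _]|[e|[lt _]]] := spm_cov hM x.
- by rewrite lt_geF //; constructor.
- by rewrite !e lexx; constructor.
- by rewrite ltW //; constructor.
Qed.

Lemma pair_max_ge x : x <= j x.
Proof. by case: pairP => // /ltW. Qed.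

Lemma pair_min_le x : k x <= x.
Proof. by case: pairP => // /ltW. Qed.

Lemma pair_max_geM x : M x <= j x.
Proof. by case: pairP => // /ltW. Qed.

Lemma pair_min_leM x : k x <= M x.
Proof. by case: pairP => // /ltW. Qed.

Lemma pair_cases x : x = k x \/ x = j x.
Proof. by case: pairP; auto. Qed.

Lemma pair_maxM x : j (M x) = j x.
Proof.
rewrite /pair_max (spm_inv hM); have [[lt _]|[e|[lt _]]] := spm_cov hM x.
- by rewrite (ltW lt) lt_geF.
- by rewrite e.
- by rewrite (ltW lt) lt_geF.
Qed.

Lemma pair_minM x : k (M x) = k x.
Proof.
rewrite /pair_min (spm_inv hM); have [[lt _]|[e|[lt _]]] := spm_cov hM x.
- by rewrite (ltW lt) lt_geF.
- by rewrite e.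
- by rewrite (ltW lt) lt_geF.
Qed.

Lemma pair_max_min x : j (k x) = j x.
Proof. by rewrite /k; case: ifP => _ //; apply: pair_maxM. Qed.

Lemma pair_min_max x : k (j x) = k x.
Proof. by rewrite /j; case: ifP => _ //; apply: pair_minM. Qed.

Lemma pair_max_idem x : j (j x) = j x.
Proof. by rewrite -pair_max_min pair_min_max pair_max_min. Qed.

(** If a cover has [M x = y], both ends form one pair. Otherwise [M x < M y], and [j x], being [x]
    or [M x], is bounded by [y] or [M y], hence by [j y]. *)
Lemma pair_max_homo : {homo j : x y / x <= y}.
Proof.
apply: homo_le_covered_by => x y xy.
have [<-|/eqP/(spm_mono hM xy)/ltW le_M] := eqVneq (M x) y.
  by rewrite pair_maxM.
case: (pairP x) => _; first exact: le_trans le_M (pair_max_geM y).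
all: by apply: le_trans (pair_max_ge y); case: xy => /ltW.
Qed.

Lemma pair_min_homo : {homo k : x y / x <= y}.
Proof.
apply: homo_le_covered_by => x y xy.
have [<-|/eqP/(spm_mono hM xy)/ltW le_M] := eqVneq (M x) y.
  by rewrite pair_minM.
case: (pairP y) => _; last exact: le_trans (pair_min_leM x) le_M.
all: by apply: le_trans (pair_min_le x) _; case: xy => /ltW.
Qed.

Lemma top_matched_lt : m < \top.
Proof. by case: (spm_top hM). Qed.

Lemma pair_min_top : k \top = m.
Proof. by rewrite /k lt_geF ?top_matched_lt. Qed.

Lemma pair_max_top_matched : j m = \top.
Proof. by rewrite pair_maxM /j lt_geF ?top_matched_lt. Qed.

Lemma pair_min_le_top_matched x : k x <= m.
Proof. by rewrite -pair_min_top pair_min_homo ?lex1. Qed.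

(** Both maps are monotone, with [j (k x) = j x] and [k (j x) = k x], so each carries the comparison
    to the other side. *)
Lemma pair_min_le_min x y : (k x <= k y) = (j x <= j y).
Proof.
apply/idP/idP => [/pair_max_homo|/pair_min_homo].
  by rewrite !pair_max_min.
by rewrite !pair_min_max.
Qed.

Lemma pair_max_eq_min x y : j x = j y -> k x = k y.
Proof. by move=> e; rewrite -pair_min_max e pair_min_max. Qed.

(** * Intermediate posets described in coordinates *)

(* After the elements of a down-set S of [0, m] have been treated, each merged
   element is represented by (p, false) for the p that was treated. Since it
   also stands for (M p, true), it lies below (r, true) as soon as M p <= r. *)
Definition stage_mem (S : {set P}) (u : P * bool) : bool :=
  (u.1 <= m) && (u.2 ==> (j u.1 \notin S)).

Definition stage_le (S : {set P}) (u v : P * bool) : bool :=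
  (u.2 ==> v.2) &&
  ((u.1 <= v.1) || [&& ~~ u.2, v.2, u.1 \in S & k u.1 <= v.1]).

(** [f] identifies [Q] with the pairs in [stage_mem S] ordered by [stage_le S]. Working through
    coordinates lets the carrier type change at each zipping or removal. *)
Record stage {d'} (Q : finTBPOrderType d') (S : {set P})
    (f : Q -> P * bool) : Prop := Stage {
  stage_sub : {in S, forall q, q <= m};
  stage_down : {in S, forall q r, r <= q -> r \in S};
  stage_im : forall a, stage_mem S (f a);
  stage_surj : forall u, stage_mem S u -> exists a, f a = u;
  stage_leE : forall a b, (a <= b) = stage_le S (f a) (f b) }.

Section Stage.
Context {d' : Order.disp_t} {Q : finTBPOrderType d'} {S : {set P}}.
Context {f : Q -> P * bool}.
Hypothesis hf : stage S f.

Lemma stage_inj : injective f.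
Proof.
move=> a b fab; apply: le_anti.
by rewrite !(stage_leE hf) fab /stage_le implybb lexx.
Qed.

Lemma stage_inverse : exists g : P * bool -> Q,
  {in stage_mem S, cancel g f} /\ cancel f g.
Proof.
(* The default [\bot] is returned only off the image of [f]. *)
pose g u : Q := odflt \bot [pick a | f a == u].
have gK : {in stage_mem S, cancel g f}.
  move=> u /(stage_surj hf)[a fa]; rewrite /g.
  by case: pickP => [b /eqP//|/(_ a)]; rewrite fa eqxx.
exists g; split=> // a; apply: stage_inj.
by rewrite gK //; apply: (stage_im hf).
Qed.

Lemma stage_top : f \top = (m, true).
Proof.
have [|a fa] := stage_surj hf (u := (m, true)).
  rewrite /stage_mem lexx /= pair_max_top_matched.
  by apply/negP=> /(stage_sub hf); rewrite lt_geF ?top_matched_lt.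
rewrite -fa; congr f; apply: le_anti; rewrite lex1 (stage_leE hf) fa /stage_le.
by rewrite implybT /=; case/andP: (stage_im hf \top) => ->.
Qed.

Lemma stage_ltE a b : (a < b) = (f a != f b) && stage_le S (f a) (f b).
Proof. by rewrite lt_neqAle (inj_eq stage_inj) (stage_leE hf). Qed.

Lemma stage_bottomP (p : P) (x a : Q) :
  p \notin S -> f x = (p, false) -> (x <= a) = (p <= (f a).1).
Proof.
by move=> pS fx; rewrite (stage_leE hf) fx /stage_le /= (negbTE pS) andbF orbF.
Qed.

Lemma stage_mem_above (p q : P) (b : bool) :
  p \notin S -> p <= q -> q <= m -> stage_mem S (q, b).
Proof.
move=> pS pq qm; rewrite /stage_mem /= qm; apply/implyP=> _.
by apply: contra pS => /(stage_down hf); apply; apply: le_trans (pair_max_ge q).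
Qed.

(** [S] is a down-set, so above an untreated [p] no first coordinate lies in [S] and the order is
    the product order. The coatom is [(m, false)]. *)
Lemma stage_splits_above (p : P) (x z : Q) :
  p \notin S -> f x = (p, false) -> f z = (p, true) -> splits_above x z.
Proof.
move=> pS fx fz; have [g [gK fK]] := stage_inverse.
have pm : p <= m by have /andP[] := stage_im hf z; rewrite fz.
have mS : m \notin S by apply: contra pS => /(stage_down hf); apply.
have gKp q b : p <= q -> q <= m -> f (g (q, b)) = (q, b).
  by move=> pq qm; apply: gK; apply: stage_mem_above pS pq qm.
have le_m a : (f a).1 <= m by case/andP: (stage_im hf a).
have fc : f (g (m, false)) = (m, false) by apply: gKp.
have xP a := stage_bottomP a pS fx.
have le_c a : (a <= g (m, false)) = ~~ (f a).2.
  by rewrite (stage_leE hf) fc /stage_le /= le_m implybF andbT.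
pose c := g (m, false).
exists c; split.
  split=> [|w].
    by rewrite stage_ltE stage_top fc /stage_le xpair_eqE andbF lexx.
  (* An element above [c] has first coordinate [m], so it is [c] or the top. *)
  apply/negP=> /andP[]; rewrite !stage_ltE fc stage_top /stage_le /=.
  case fw: (f w) => [q b] /=; rewrite (negbTE mS) /= andbF orbF => /andP[cw mq].
  have qm : q = m by apply: le_anti; rewrite mq -[q]/((q, b).1) -fw le_m.
  by move: cw; rewrite qm; case: b {fw}; rewrite ?eqxx.
have x_in1 : x <= x <= \top by rewrite lexx lex1.
have x_inc : x <= x <= c by rewrite lexx le_c fx.
(* The defaults of [insubd] in [phi] and [psi] are never reached, as [phi1] and [psiE] show. *)
pose phi (a : itv x \top) : itv x c *p bool :=
  (insubd (Sub x x_inc : itv x c) (g ((f (val a)).1, false)), (f (val a)).2).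
pose psi (e : itv x c *p bool) : itv x \top :=
  insubd (Sub x x_in1 : itv x \top) (g ((f (val e.1)).1, e.2)).
have p_le1 (a : itv x \top) : p <= (f (val a)).1.
  by rewrite -xP; case/andP: (valP a).
have p_lec (a : itv x c) : p <= (f (val a)).1.
  by rewrite -xP; case/andP: (valP a).
have phi1 a : val (phi a).1 = g ((f (val a)).1, false).
  by rewrite insubdK // unfold_in xP le_c gKp //= p_le1.
have psiE e : val (psi e) = g ((f (val e.1)).1, e.2).
  by rewrite insubdK // unfold_in xP lex1 gKp //= p_lec.
have fphi a : f (val (phi a).1) = ((f (val a)).1, false) by rewrite phi1 gKp.
have fc2 (a : itv x c) : (f (val a)).2 = false.
  by apply/negbTE; rewrite -le_c; case/andP: (valP a).
exists phi; split.
  split.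
    exists psi => [a|[a b]].
      by apply: val_inj; rewrite psiE fphi /= -surjective_pairing fK.
    congr pair; last by rewrite psiE gKp.
    apply: val_inj; rewrite phi1 psiE gKp ?p_lec ?le_m //.
    by rewrite -[RHS]fK [f (val a)]surjective_pairing fc2.
  move=> a b; rewrite leEprod -!Order.le_val !(stage_leE hf) !fphi /stage_le /=.
  have aS : (f (val a)).1 \notin S.
    by apply: contra pS => /(stage_down hf); apply.
  by rewrite (negbTE aS) !andbF !orbF le_implyb andbC.
have z_in : x <= z <= \top by rewrite xP fz lexx lex1.
exists (Sub z z_in); split; rewrite ?SubK //; last by rewrite /phi SubK fz.
by rewrite phi1 SubK fz /= -fx fK.
Qed.

(** Now [S] is all of [[0, m]]. The pairs [(q, false)] account for the elements below [m]; the
    surviving [(q, true)] have [j q] not below [m] and account for the others through [j q]. *)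
Lemma stage_final_iso : (forall q, q <= m -> q \in S) -> isomorphic Q P.
Proof.
move=> mS; have [g [gK _]] := stage_inverse.
pose h a := if (f a).2 then j (f a).1 else (f a).1.
pose h' v := g (if v <= m then (v, false) else (k v, true)).
have h_mono : {mono h : a b / a <= b}.
  move=> a b; rewrite (stage_leE hf) /h.
  have := stage_im hf a; have := stage_im hf b; rewrite /stage_mem /stage_le.
  case: (f a) (f b) => q b1 [r b2] /= /andP[rm jr] /andP[qm jq].
  (* As [v <= m] puts [v] in [S], [v] is not [j v]. *)
  have kE v : v <= m -> j v \notin S -> k v = v.
    move=> vm jv; have [<-//|vE] := pair_cases v.
    by rewrite -vE mS in jv.
  case: b1 b2 jr jq => [] [] /= jr jq; rewrite ?orbF ?mS //=.
  - by rewrite -pair_min_le_min !kE.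
  - by apply: contraNF jq => jqr; apply: mS (le_trans jqr rm).
  - apply/idP/orP => [/pair_min_homo|[qr|/pair_max_homo]].
    + by rewrite pair_min_max [k r]kE //; right.
    + exact: le_trans qr (pair_max_ge r).
    + by rewrite pair_max_min; apply: le_trans (pair_max_ge q).
have h_inj : injective h.
  by move=> a b hab; apply: le_anti; rewrite -!h_mono hab lexx.
have hK : cancel h' h.
  move=> v; rewrite /h'; case: ifP => vm; rewrite /h.
    by rewrite gK // unfold_in /stage_mem /= vm.
  (* [k v <= m] always holds, so [v] outside [[0, m]] is the larger of its pair. *)
  have vE : j v = v.
    by have [vE|//] := pair_cases v; rewrite vE pair_min_le_top_matched in vm.
  rewrite gK /= ?pair_max_min // unfold_in /stage_mem /=.
  rewrite pair_min_le_top_matched pair_max_min vE; apply/negP=> /(stage_sub hf).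
  by rewrite vm.
by exists h; split=> //; exists h' => //; apply: inj_can_sym.
Qed.

End Stage.

(** * Treating one minimal untreated element [p] *)

Section Step.
Context {d' : Order.disp_t} {Q : finTBPOrderType d'} {S : {set P}}.
Context {f : Q -> P * bool} {p : P}.
Hypotheses (hf : stage S f) (pm : p <= m) (pS : p \notin S).
Hypothesis p_min : forall q, q < p -> q \in S.

Lemma next_ideal :
  {in p |: S, forall q, q <= m} /\
  {in p |: S, forall q r, r <= q -> r \in p |: S}.
Proof.
split=> q; rewrite !inE => /predU1P[->//|].
- exact: (stage_sub hf).
- move=> r; rewrite !inE le_eqVlt => /predU1P[->|/p_min->].
    by rewrite eqxx.
  by rewrite orbT.
- by move=> qS r /(stage_down hf qS) rS; rewrite !inE rS orbT.
Qed.

Lemma next_mem u :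
  stage_mem (p |: S) u = stage_mem S u && (u.2 ==> (j u.1 != p)).
Proof.
rewrite /stage_mem !inE negb_or -andbA; congr andb.
by case: u.2 => /=; first exact: andbC.
Qed.

(** Only [(p, false)] gains a new clause, and that clause adds nothing when [k p = p]. *)
Lemma next_le u v :
  k p = p \/ u != (p, false) -> stage_le (p |: S) u v = stage_le S u v.
Proof.
case: u => q b /=; rewrite /stage_le /= !inE.
have [->|//] := eqVneq q p; rewrite (negbTE pS) !andbF orbF => -[->|].
  by case: (p <= v.1); rewrite ?andbF.
by case: b; rewrite ?eqxx.
Qed.

(** No [q] has [j q = p], by idempotence of [j], so no pair disappears; and [k p = p] leaves the
    order unchanged. *)
Lemma stage_skip : j p != p -> stage (p |: S) f.
Proof.
move=> jp.
have kp : k p = p.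
  by have [<-//|jpE] := pair_cases p; rewrite -jpE eqxx in jp.
have memE u : stage_mem (p |: S) u = stage_mem S u.
  rewrite next_mem; case: eqP => [jup|_]; last by rewrite implybT andbT.
  by rewrite -jup pair_max_idem eqxx in jp.
have [sub down] := next_ideal; split=> // [a|u|a b].
- by rewrite memE (stage_im hf).
- by rewrite memE; apply: (stage_surj hf).
- by rewrite next_le ?(stage_leE hf); auto.
Qed.

Section Reduce.
Context {x z : Q}.
Hypotheses (jp : j p = p) (fx : f x = (p, false)) (fz : f z = (p, true)).

(** Otherwise [p = m], whence [p = j p = j m] is the top of [P], against [m < \top]. *)
Lemma stage_reduced_neq_top : z != \top.
Proof.
apply/eqP=> z1; move: fz; rewrite z1 (stage_top hf) => -[mp].
have p1 : p = \top by rewrite -jp -mp pair_max_top_matched.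
by have := top_matched_lt; rewrite mp p1 ltxx.
Qed.

(** For [(q, true)], monotonicity gives [j q <= p]; survival and minimality of [p] force [j q = p],
    so [q] is [k p]. For [(q, false)], even [k q <= p] yields [q <= j q <= p]. *)
Lemma stage_lt_reduced a : a < z -> a <= x \/ f a = (k p, true).
Proof.
rewrite (stage_ltE hf) (stage_leE hf) fx fz; have := stage_im hf a.
rewrite /stage_mem /stage_le; case: (f a) => q [] /= /andP[_].
  rewrite orbF => jq /andP[qp le_qp]; right; congr pair.
  have := pair_max_homo le_qp.
  rewrite jp le_eqVlt => /predU1P[jqp|/p_min]; last by rewrite (negbTE jq).
  have [->|qE] := pair_cases q; first by apply: pair_max_eq_min; rewrite jp.
  by rewrite qE jqp eqxx in qp.
move=> _ /andP[_ /orP[->|/andP[_ /pair_max_homo]]]; first by left.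
rewrite pair_max_min jp => jq; left.
by rewrite (le_trans (pair_max_ge q)).
Qed.

Lemma stage_removable : k p = p -> removable z.
Proof.
move=> kp; split; first exact: stage_reduced_neq_top.
exists x; split; last exact: stage_splits_above pS fx fz.
have xz : x < z.
  by rewrite (stage_ltE hf) fx fz /stage_le /= lexx xpair_eqE /= andbF.
have coverE w : covered_by w z <-> w \in [:: x].
  apply: covered_by_generators.
  - by move=> v; rewrite mem_seq1 => /eqP->.
  - move=> v vz; rewrite /= orbF; case: (stage_lt_reduced vz) => //.
    by rewrite kp -fz => /(stage_inj hf) vE; rewrite vE ltxx in vz.
  - by move=> u v; rewrite !mem_seq1 => /eqP-> /eqP->.
by move=> w; apply: (iff_trans (coverE w)); rewrite mem_seq1; split=> /eqP.
Qed.

(** If [j q = p = k p] then [q = p], so [z] is the only pair that leaves. *)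
Lemma stage_removal (h : removable z) :
  k p = p -> stage (p |: S) (fun a : removal h => f (val a)).
Proof.
move=> kp; have [sub down] := next_ideal; split=> // [a|u|a b].
- rewrite next_mem (stage_im hf) /=; apply/implyP=> a2; apply/eqP=> ja.
  have ka : k (f (val a)).1 = p.
    by rewrite -[in RHS]kp; apply: pair_max_eq_min; rewrite jp.
  have aE : f (val a) = f z.
    rewrite fz [LHS]surjective_pairing a2; congr pair.
    by have [->|->] := pair_cases (f (val a)).1.
  by have := valP a; rewrite (stage_inj hf aE) eqxx.
- rewrite next_mem => /andP[/(stage_surj hf)[a fa] u2].
  have az : a != z.
    by apply: contraTneq u2 => az; rewrite -fa az fz /= jp eqxx.
  by exists (Sub a az); rewrite SubK.
- by rewrite next_le -?(stage_leE hf); auto.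
Qed.

Context {y : Q}.
Hypothesis fy : f y = (k p, true).

(** [x] and [y] are incomparable and, by [stage_lt_reduced], generate everything below [z]. *)
Lemma stage_clean_zipper : k p != p -> clean_zipper x y z.
Proof.
move=> kp; have kp_lt : k p < p by rewrite lt_neqAle kp pair_min_le.
have leE := stage_leE hf; have xP a := stage_bottomP hf a pS fx.
have kpS : k p \in S by apply: p_min.
have xz : x < z.
  by rewrite (stage_ltE hf) fx fz /stage_le /= lexx xpair_eqE /= andbF.
have yz : y < z.
  rewrite (stage_ltE hf) fy fz /stage_le /= (ltW kp_lt) xpair_eqE /=.
  by rewrite (negbTE kp).
have xy : (x <= y) = false by rewrite xP fy /= lt_geF.
have yx : (y <= x) = false by rewrite leE fx fy.
have uniq_xyz : uniq [:: x; y; z].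
  rewrite /= !inE negb_or (lt_eqF xz) (lt_eqF yz) !andbT.
  by apply/eqP=> xyE; rewrite xyE lexx in xy.
have coverE w : covered_by w z <-> w \in [:: x; y].
  apply: covered_by_generators.
  - by move=> v; rewrite !inE => /orP[]/eqP->.
  - move=> v /stage_lt_reduced[|]; rewrite /= orbF; first by move->.
    by rewrite -fy => /(stage_inj hf)->; rewrite lexx orbT.
  - by move=> u v; rewrite !inE => /orP[]/eqP-> /orP[]/eqP->; rewrite ?xy ?yx.
split; [split=> //|exact: stage_reduced_neq_top
       |exact: stage_splits_above pS fx fz].
- move=> w; apply: (iff_trans (coverE w)); rewrite !inE.
  by split=> [/orP[]/eqP|[]->]; rewrite ?eqxx ?orbT; auto.
(* Being above [x] gives first coordinate at least [p]; being above [y] gives flag [true]. *)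
- split; [exact: ltW|exact: ltW|] => w; rewrite xP !leE fy fz /stage_le /=.
  by move=> pw /andP[->]; rewrite pw.
- move=> a; have := stage_im hf a.
  rewrite !(stage_ltE hf) fx fy /stage_mem /stage_le.
  case: (f a) => q [] /= /andP[_].
    (* No [(q, true)] lies strictly below [y]: it would have [j q = p], so [q] would be [k p] or
       [p]. *)
    move=> jq; rewrite andbF orbF; apply/esym/negP=> /andP[qkp le_qkp].
    have := pair_max_homo le_qkp; rewrite pair_max_min jp.
    rewrite le_eqVlt => /predU1P[jqp|/p_min]; last by rewrite (negbTE jq).
    have kqp : k q = k p by apply: pair_max_eq_min; rewrite jp.
    have [qE|qE] := pair_cases q; first by rewrite qE kqp eqxx in qkp.
    by rewrite qE jqp lt_geF in le_qkp.
  (* For [(q, false)], [q < p] means [q] is treated, and then [k q <= k p] places it below [y]. *)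
  move=> _; rewrite orbF !xpair_eqE /= !andbT andbF /= -lt_neqAle.
  apply/idP/idP => [qp|/orP[le_qkp|/andP[qS]]].
  + by rewrite p_min //= pair_min_homo ?orbT ?ltW.
  + exact: le_lt_trans kp_lt.
  + rewrite pair_min_le_min jp => jqp; rewrite lt_neqAle.
    rewrite (le_trans (pair_max_ge q) jqp) andbT.
    by apply: contraNneq pS => <-.
Qed.

(** The merged element keeps the coordinates [(p, false)] of [x]; [y] and [z] are the only pairs
    [(q, true)] with [j q = p]. *)
Lemma stage_zipping (h : clean_zipper x y z) :
  k p != p ->
  stage (p |: S) (fun a : zipping h => if a is Some b then f (val b) else f x).
Proof.
move=> kp; have [sub down] := next_ideal; have leE := stage_leE hf.
split=> // [a|u|a b].
- have : stage_mem (p |: S) (f x) by rewrite next_mem (stage_im hf) fx.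
  case: a => // a _; rewrite next_mem (stage_im hf) /=; apply/implyP=> a2.
  apply/eqP=> ja; have := valP a; rewrite !inE -!(inj_eq (stage_inj hf)) fy fz.
  rewrite [f (val a)]surjective_pairing a2.
  have ka : k (f (val a)).1 = k p by apply: pair_max_eq_min; rewrite jp.
  by have [->|->] := pair_cases (f (val a)).1; rewrite ?ka ?ja eqxx ?orbT.
- rewrite next_mem => /andP[/(stage_surj hf)[a fa] u2].
  have [ax|ax] := eqVneq a x; first by exists None; rewrite -ax.
  have a_old : a \notin [:: x; y; z].
    rewrite !inE negb_or ax /=; apply: contraTN u2 => /orP[]/eqP aE.
      by rewrite -fa aE fy /= pair_max_min jp eqxx.
    by rewrite -fa aE fz /= jp eqxx.
  by exists (Some (Sub a a_old)); rewrite SubK.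
- have old_x (c : {a : Q | a \notin [:: x; y; z]}) : f (val c) != (p, false).
    rewrite -fx (inj_eq (stage_inj hf)).
    by have := valP c; rewrite !inE negb_or => /andP[].
  rewrite /Order.le /= /zipping_le; case: a b => [a|] [b|].
  + by rewrite leE next_le //; right; apply: old_x.
  + by rewrite leE next_le //; right; apply: old_x.
  (* The alternative [y <= b] is exactly the clause gained by [(p, false)]. *)
  + rewrite (stage_bottomP hf _ pS fx) leE fx fy /stage_le /= !inE eqxx /=.
    by rewrite orbF.
  + by rewrite fx /stage_le /= lexx.
Qed.

End Reduce.
End Step.

(** * The full reduction, by induction on the number of elements outside [S] *)

Lemma stage_reduces {d'} (Q : finTBPOrderType d') (S : {set P})
    (f : Q -> P * bool) :
  stage S f -> exists R, zip_remove_seq Q R /\ isomorphic R P.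
Proof.
have [n] := ubnP #|~: S|; elim: n Q S f => // n IHn Q S f le_n hf.
have [mS|[q0]] := set_0Vmem [set q | q <= m & q \notin S].
  exists Q; split; first exact: zrs_nil.
  apply: (stage_final_iso hf) => q qm.
  by have /setP/(_ q) := mS; rewrite !inE qm => /negbFE.
(* Minimizing the number of elements below picks an order-minimal untreated [p]. *)
rewrite inE => q0P; pose ht (q : P) := #|[set r : P | r < q]|.
have [p /andP[pm pS] p_le] :=
  @arg_minnP _ q0 (fun q => (q <= m) && (q \notin S)) ht q0P.
have p_min q : q < p -> q \in S.
  move=> qp; apply: contraTT (qp) => qS.
  have /p_le : (q <= m) && (q \notin S) by rewrite qS (le_trans (ltW qp)).
  rewrite leqNgt => /negP[]; apply/proper_card/properP; split.
    by apply/subsetP=> r; rewrite !inE => /lt_trans; apply.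
  by exists q; rewrite !inE ?ltxx.
have lt_n : (#|~: (p |: S)| < n)%N.
  rewrite -ltnS; apply: leq_trans le_n; rewrite ltnS.
  apply/proper_card/properP; split; first by rewrite setCS subsetUr.
  by exists p; rewrite !inE ?eqxx.
have [jp|jp] := eqVneq (j p) p; last first.
  exact: IHn lt_n (stage_skip hf pm pS p_min jp).
have [|x fx] := stage_surj hf (u := (p, false)); first by rewrite /stage_mem pm.
have [|z fz] := stage_surj hf (u := (p, true)).
  by rewrite /stage_mem pm jp.
have [kp|kp] := eqVneq (k p) p.
  have h := stage_removable hf pS p_min jp fx fz kp.
  have hf' := stage_removal hf pm pS p_min jp fz h kp.
  have [R [seqR isoR]] := IHn _ _ _ lt_n hf'.
  by exists R; split=> //; apply: zrs_remove seqR.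
have [|y fy] := stage_surj hf (u := (k p, true)).
  by rewrite /stage_mem pair_min_le_top_matched /= pair_max_min jp.
have h := stage_clean_zipper hf pS p_min jp fx fz fy kp.
have hf' := stage_zipping hf pm pS p_min jp fx fz fy h kp.
have [R [seqR isoR]] := IHn _ _ _ lt_n hf'.
by exists R; split=> //; apply: zrs_zip seqR.
Qed.

End Matching.

Theorem theorem5p4 (d : Order.disp_t) (P : finTBPOrderType d) (M : P -> P)
    (hM : special_partial_matching M) :
  exists Q : finTBPOrderType _,
    zip_remove_seq (itv \bot (M \top) *p bool : finTBPOrderType _) Q /\
    isomorphic Q P.
Proof.
pose Q0 : finTBPOrderType _ := (itv \bot (M \top) *p bool)%type.
pose f (e : itv \bot (M \top) *p bool) := (val e.1, e.2).
(* With [S] empty nothing is deleted and [stage_le] is the product order. *)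
have stage0 : @stage _ _ M _ Q0 set0 f; last exact: (stage_reduces hM stage0).
split=> [q|q|[a b]|[q b]|[a b] [a' b']]; rewrite ?inE //.
- by rewrite /stage_mem inE implybT andbT; case/andP: (valP a).
- rewrite /stage_mem => /andP[qm _].
  have q_in : \bot <= q <= M \top by rewrite le0x.
  by exists (Sub q q_in : itv _ _, b); rewrite /f SubK.
- by rewrite /stage_le inE /= !andbF orbF leEprod le_implyb andbC -Order.le_val.
Qed.
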